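(* Let $g_1^{ij}(u)$ and $g_2^{ij}(u)$ be two Riemannian or pseudo-Riemannian contravariant metrics, and let $v^i_j(u)=g_1^{is}(u)\,g_{2,sj}(u)$. 1) If for any linear combination $g^{ij}(u)=\lambda_1 g_1^{ij}(u)+\lambda_2 g_2^{ij}(u)$, where $\lambda_1,\lambda_2$ are arbitrary constants such that $\det(g^{ij}(u))\not\equiv 0$, the relation $\Gamma^{ij}_k(u)=\lambda_1\Gamma^{ij}_{1,k}(u)+\lambda_2\Gamma^{ij}_{2,k}(u)$ is fulfilled, then the Nijenhuis tensor of the affinor $v^i_j(u)$ vanishes. Thus, for compatible and for almost compatible metrics, the corresponding Nijenhuis tensor always vanishes. 2) If the pair of metrics $g_1^{ij}(u)$ and $g_2^{ij}(u)$ is nonsingular, that is, the roots $\lambda$ of the equation $\det(g_1^{ij}(u)-\lambda g_2^{ij}(u))=0$ are distinct, then it follows from the vanishing of the Nijenhuis tensor of the affinor $v^i_j(u)$ that the metrics $g_1^{ij}(u)$ and $g_2^{ij}(u)$ are compatible. Thus, a nonsingular pair of metrics is compatible if and only if the metrics are almost compatible.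
   Context: Everything is local, $u=(u^1,\dots,u^N)$ are local coordinates, and repeated indices are summed. A contravariant metric $g^{ij}(u)$ is a smooth nondegenerate symmetric field with upper indices; $g_{ij}(u)$ is its inverse, $g^{is}g_{sj}=\delta^i_j$. For a metric $g^{ij}$, $\Gamma^i_{jk}$ are the coefficients of its Levi--Civita connection, $\Gamma^{ij}_k=g^{is}\Gamma^j_{sk}$, and the curvature is $$R^i_{jkl}=-\frac{\partial\Gamma^i_{jl}}{\partial u^k}+\frac{\partial\Gamma^i_{jk}}{\partial u^l}-\Gamma^i_{pk}\Gamma^p_{jl}+\Gamma^i_{pl}\Gamma^p_{jk},\qquad R^{ij}_{kl}=g^{is}R^j_{skl}.$$ The subscripts $1,2$ in $\Gamma_{1},\Gamma_2,R_1,R_2,g_{1,ij},g_{2,ij}$ refer to the metrics $g_1^{ij}$, $g_2^{ij}$; objects without such a subscript refer to the linear combination $g^{ij}=\lambda_1g_1^{ij}+\lambda_2g_2^{ij}$; each raises and lowers indices with its own metric. The metrics $g_1^{ij}$, $g_2^{ij}$ are called almost compatible if for all constants $\lambda_1,\lambda_2$ such that $\det(\lambda_1g_1^{ij}+\lambda_2g_2^{ij})\not\equiv0$ one has $\Gamma^{ij}_k=\lambda_1\Gamma^{ij}_{1,k}+\lambda_2\Gamma^{ij}_{2,k}$. They are called compatible if for all such $\lambda_1,\lambda_2$ one has both $\Gamma^{ij}_k=\lambda_1\Gamma^{ij}_{1,k}+\lambda_2\Gamma^{ij}_{2,k}$ and $R^{ij}_{kl}=\lambda_1R^{ij}_{1,kl}+\lambda_2R^{ij}_{2,kl}$.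 An affinor is a $(1,1)$-tensor field. The Nijenhuis tensor of an affinor $v^i_j(u)$ is $$N^k_{ij}=v^s_i\frac{\partial v^k_j}{\partial u^s}-v^s_j\frac{\partial v^k_i}{\partial u^s}+v^k_s\frac{\partial v^s_i}{\partial u^j}-v^k_s\frac{\partial v^s_j}{\partial u^i}.$$ The ''corresponding Nijenhuis tensor'' of the pair $g_1,g_2$ is that of $v^i_j=g_1^{is}g_{2,sj}$. *)

(* Defs.v *)
From HB Require Import structures.
From mathcomp Require Import all_boot all_order all_algebra.
From mathcomp Require Import all_classical all_reals all_analysis.
From mathcomp Require Import complex.
Set Implicit Arguments.
Unset Strict Implicit.
Unset Printing Implicit Defensive.
Import Order.TTheory GRing.Theory Num.Theory.
Import numFieldNormedType.Exports.
Local Open Scope classical_set_scope.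
Local Open Scope ring_scope.

(* Points of R^N are row vectors.  A field with two indices is a matrix-valued
   function: the row is the first index of a tensor with two upper indices
   (or two lower ones), and the upper index of an affinor.  All fields are
   total functions; only their values on an open set U, where they are assumed
   to be regular, are meaningful. *)

Definition partial {R : realType} {N : nat} (i : 'I_N) (f : 'rV[R]_N -> R) :
    'rV[R]_N -> R :=
  fun u => 'D_(delta_mx 0 i) f u.

(* C^infinity: every iterated partial derivative exists and is continuous. *)
Definition smooth_on {R : realType} {N : nat} (U : set 'rV[R]_N)
    (f : 'rV[R]_N -> R) : Prop :=
  forall (s : seq 'I_N) (u : 'rV[R]_N), U u ->
    {for u, continuous (foldr partial f s)} /\
    (forall i : 'I_N, derivable (foldr partial f s) u (delta_mx 0 i)).

(* No condition on the signature. *)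
Definition contravariant_metric {R : realType} {N : nat} (U : set 'rV[R]_N)
    (g : 'rV[R]_N -> 'M[R]_N) : Prop :=
  [/\ forall i j, smooth_on U (fun u => g u i j),
      forall u, U u -> (g u)^T = g u
    & forall u, U u -> \det (g u) != 0].

(* g_{ij}.  [invmx] is the genuine inverse only where det g <> 0; everything
   below that depends on it is used at such points only. *)
Definition lower {R : realType} {N : nat} (g : 'rV[R]_N -> 'M[R]_N) :
    'rV[R]_N -> 'M[R]_N :=
  fun u => invmx (g u).

(* [christoffel g i j k] is Gamma^i_{jk}, for the Levi-Civita connection. *)
Definition christoffel {R : realType} {N : nat} (g : 'rV[R]_N -> 'M[R]_N)
    (i j k : 'I_N) : 'rV[R]_N -> R :=
  fun u => 2^-1 * \sum_(s < N) g u i s *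
    (partial j (fun w => lower g w s k) u
     + partial k (fun w => lower g w j s) u
     - partial s (fun w => lower g w j k) u).

(* [christoffel_up g i j k] is Gamma^{ij}_k = g^{is} Gamma^j_{sk}. *)
Definition christoffel_up {R : realType} {N : nat} (g : 'rV[R]_N -> 'M[R]_N)
    (i j k : 'I_N) : 'rV[R]_N -> R :=
  fun u => \sum_(s < N) g u i s * christoffel g j s k u.

(* [curvature g i j k l] is R^i_{jkl}; note the sign convention. *)
Definition curvature {R : realType} {N : nat} (g : 'rV[R]_N -> 'M[R]_N)
    (i j k l : 'I_N) : 'rV[R]_N -> R :=
  fun u =>
    - partial k (christoffel g i j l) u
    + partial l (christoffel g i j k) u
    - \sum_(p < N) christoffel g i p k u * christoffel g p j l u
    + \sum_(p < N) christoffel g i p l u * christoffel g p j k u.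

(* [curvature_up g i j k l] is R^{ij}_{kl} = g^{is} R^j_{skl}. *)
Definition curvature_up {R : realType} {N : nat} (g : 'rV[R]_N -> 'M[R]_N)
    (i j k l : 'I_N) : 'rV[R]_N -> R :=
  fun u => \sum_(s < N) g u i s * curvature g j s k l u.

Definition pencil {R : realType} {N : nat} (g1 g2 : 'rV[R]_N -> 'M[R]_N)
    (l1 l2 : R) : 'rV[R]_N -> 'M[R]_N :=
  fun u => l1 *: g1 u + l2 *: g2 u.

Definition det_not_identically_zero {R : realType} {N : nat}
    (U : set 'rV[R]_N) (g : 'rV[R]_N -> 'M[R]_N) : Prop :=
  exists2 u, U u & \det (g u) != 0.

(* The Levi-Civita connection of a linear combination exists only where the
   combination is nondegenerate, so that is where the identities are stated. *)
Definition connection_linear {R : realType} {N : nat} (U : set 'rV[R]_N)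
    (g1 g2 : 'rV[R]_N -> 'M[R]_N) (l1 l2 : R) : Prop :=
  forall u, U u -> \det (pencil g1 g2 l1 l2 u) != 0 ->
  forall i j k,
    christoffel_up (pencil g1 g2 l1 l2) i j k u =
    l1 * christoffel_up g1 i j k u + l2 * christoffel_up g2 i j k u.

Definition curvature_linear {R : realType} {N : nat} (U : set 'rV[R]_N)
    (g1 g2 : 'rV[R]_N -> 'M[R]_N) (l1 l2 : R) : Prop :=
  forall u, U u -> \det (pencil g1 g2 l1 l2 u) != 0 ->
  forall i j k l,
    curvature_up (pencil g1 g2 l1 l2) i j k l u =
    l1 * curvature_up g1 i j k l u + l2 * curvature_up g2 i j k l u.

Definition almost_compatible {R : realType} {N : nat} (U : set 'rV[R]_N)
    (g1 g2 : 'rV[R]_N -> 'M[R]_N) : Prop :=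
  forall l1 l2 : R, det_not_identically_zero U (pencil g1 g2 l1 l2) ->
    connection_linear U g1 g2 l1 l2.

Definition compatible {R : realType} {N : nat} (U : set 'rV[R]_N)
    (g1 g2 : 'rV[R]_N -> 'M[R]_N) : Prop :=
  forall l1 l2 : R, det_not_identically_zero U (pencil g1 g2 l1 l2) ->
    connection_linear U g1 g2 l1 l2 /\ curvature_linear U g1 g2 l1 l2.

(* v^i_j = g_1^{is} g_{2,sj} *)
Definition affinor {R : realType} {N : nat} (g1 g2 : 'rV[R]_N -> 'M[R]_N) :
    'rV[R]_N -> 'M[R]_N :=
  fun u => g1 u *m lower g2 u.

(* [nijenhuis v k i j] is N^k_{ij}. *)
Definition nijenhuis {R : realType} {N : nat} (v : 'rV[R]_N -> 'M[R]_N)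
    (k i j : 'I_N) : 'rV[R]_N -> R :=
  fun u => \sum_(s < N)
    (v u s i * partial s (fun w => v w k j) u
     - v u s j * partial s (fun w => v w k i) u
     + v u k s * partial j (fun w => v w s i) u
     - v u k s * partial i (fun w => v w s j) u).

Definition nijenhuis_vanishes {R : realType} {N : nat} (U : set 'rV[R]_N)
    (v : 'rV[R]_N -> 'M[R]_N) : Prop :=
  forall u, U u -> forall k i j, nijenhuis v k i j u = 0.

(* The metrics may be indefinite, so the roots of the degree N polynomial
   det (g_1 - lambda g_2) in lambda are taken in the complex numbers R[i];
   being distinct (no multiple root) means that there are N of them. *)
Definition nonsingular_pair {R : realType} {N : nat} (U : set 'rV[R]_N)
    (g1 g2 : 'rV[R]_N -> 'M[R]_N) : Prop :=
  forall u, U u ->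
    exists roots : seq R[i],
      [/\ uniq roots, size roots = N
        & forall lambda : R[i],
            lambda \in roots <->
            \det (map_mx (real_complex R) (g1 u)
                  - lambda *: map_mx (real_complex R) (g2 u)) = 0].

(* Main.v *)
Require Import Defs.
From mathcomp Require Import all_boot all_order all_algebra.
From mathcomp Require Import all_classical all_reals all_analysis.
From mathcomp Require Import complex ring lra.
Import numFieldNormedType.Exports.
Set Implicit Arguments.
Unset Strict Implicit.
Unset Printing Implicit Defensive.
Import Order.TTheory GRing.Theory Num.Theory.
Local Open Scope classical_set_scope.
Local Open Scope ring_scope.

(** Everything reduces to pointwise algebra of the difference tensor
    T^p_{ab} = Gamma^p_{1,ab} - Gamma^p_{2,ab}, seen for each upper index p as
    a symmetric matrix T^p.  No adapted coordinates are used; in particular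
    complex roots need no separate treatment.

    Connections.  The coefficients Gamma^{ij}_k of a metric g are determined by
    two linear equations: their symmetrization in (i, j) is - d_k g^{ij}, and
    g^{is} Gamma^{jk}_s is symmetric in (i, j)
    ([levi_civita_unique]).  The combination l1 Gamma_1 + l2 Gamma_2 always
    satisfies the first equation for l1 g1 + l2 g2; the second equation fails
    by l1 l2 (g1 T^p g2 - g2 T^p g1) ([pencil_torsion]).  Hence the relation
    between connections, for one pair of nonzero l1, l2 or for all of them, is
    the condition g1 T^p g2 = g2 T^p g1 for every p.  It says that the affinor
    v = g1 g2^{-1} is self-adjoint for each of the forms T^p.

    Nijenhuis tensor.  Write the derivatives of v through the two connections;
    the contribution of Gamma_2 alone cancels, and what is left is built from
    the skew matrices Z^p = T^p v - v^T T^p ([nijenhuis_connection]).  After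
    lowering p with g2 it has the form b + c - a, where a, b, c are the three
    cyclic permutations of one tensor that is skew in two indices; such
    expressions vanish identically only if the tensor does.  So the Nijenhuis
    tensor vanishes at a point if and only if v is self-adjoint there
    ([nijenhuis_zero_iff_self_adjoint]).  This already proves the first part
    and shows that vanishing of the Nijenhuis tensor gives almost
    compatibility.

    Curvature.  R^{ij}_{kl} is the sum of derivatives of Gamma^{ij}_k, which
    are linear along the pencil once the connections are, and of a term that
    is quadratic in Gamma and involves g ([curvature_upE]).  The defect of
    linearity of the quadratic term is - l1 l2 T^i g1 g^{-1} g2 T^j, skewed in
    (i, j) ([pencil_curvature_quadratic]).  Self-adjointness says that each
    Y^i = T^i g2 commutes with w = g2^{-1} g1, and the defect is a product of
    Y^i, Y^j and functions of w.  When w has N distinct complex eigenvalues,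
    all matrices commuting with w commute with each other
    ([comm_mx_simple_spectrum]), so i and j can be exchanged and the defect
    cancels ([cross_term_sym]). *)

(** * Commutants of matrices with simple spectrum *)

(** n distinct eigenvalues leave room only for one-dimensional eigenspaces,
    and these span.  A matrix commuting with w preserves each of these lines,
    hence acts on it by a scalar; two such matrices therefore commute on a
    spanning set. *)
Lemma comm_mx_simple_spectrum (F : fieldType) (n : nat) (w Y Z : 'M[F]_n)
    (r : seq F) :
  uniq r -> size r = n -> (forall a, a \in r -> eigenvalue w a) ->
  comm_mx w Y -> comm_mx w Z -> comm_mx Y Z.
Proof.
move=> r_uniq r_size r_eig wY wZ.
pose a_ (i : 'I_n) := r`_i.
have a_inj : {in predT &, injective a_}.
  move=> i j _ _ /eqP; rewrite nth_uniq ?r_size ?ltn_ord // => /eqP.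
  exact: val_inj.
have a_rank i : (0 < \rank (eigenspace w (a_ i)))%N.
  have := r_eig (a_ i); rewrite mem_nth ?r_size ?ltn_ord // => /(_ isT).
  by rewrite /eigenvalue lt0n mxrank_eq0.
have /mxdirectP rank_sum := mxdirect_sum_eigenspace w a_inj.
rewrite /= in rank_sum.
have rank_ge : (n <= \rank (\sum_i eigenspace w (a_ i))%MS)%N.
  rewrite rank_sum -[X in (X <= _)%N]card_ord -sum1_card.
  by apply: leq_sum => i _.
have full : row_full (\sum_i eigenspace w (a_ i))%MS.
  by rewrite /row_full eqn_leq rank_leq_col rank_ge.
have rank1 i : \rank (eigenspace w (a_ i)) = 1%N.
  apply/eqP; rewrite eqn_leq a_rank andbT leqNgt; apply/negP => rank_gt1.
  have : (n < \rank (\sum_i eigenspace w (a_ i))%MS)%N.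
    rewrite rank_sum (bigD1 i) //= -[X in (X < _)%N]card_ord -sum1_card.
    rewrite (bigD1 i) //= -addSn leq_add //.
    by apply: leq_sum => j _.
  by rewrite ltnNge rank_leq_col.
have scaled X (i : 'I_n) (e : 'rV_n) : comm_mx w X ->
    (e <= eigenspace w (a_ i))%MS -> e != 0 -> exists c, e *m X = c *: e.
  move=> wX e_eig e0.
  have eX : (e *m X <= eigenspace w (a_ i))%MS.
    exact: submx_trans (submxMr X e_eig) (comm_mx_stable_eigenspace _ wX).
  have e_rank : (e == eigenspace w (a_ i))%MS.
    by rewrite -(geq_leqif (mxrank_leqif_eq e_eig)) rank1 lt0n mxrank_eq0.
  by apply/sub_rVP; rewrite (eqmxP e_rank).
have killed i : (eigenspace w (a_ i) <= kermx (Y *m Z - Z *m Y))%MS.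
  apply/row_subP => k; set e := row k _.
  have e_eig : (e <= eigenspace w (a_ i))%MS by apply: row_sub.
  apply/sub_kermxP.
  have [->|e0] := eqVneq e 0; first by rewrite mul0mx.
  have [y ey] := scaled Y i e wY e_eig e0.
  have [z ez] := scaled Z i e wZ e_eig e0.
  rewrite mulmxBr !mulmxA ey ez -!scalemxAl ey ez !scalerA mulrC.
  by rewrite subrr.
have ker_full : (1%:M <= kermx (Y *m Z - Z *m Y))%MS.
  by apply: submx_trans (submx_full _ full) _; apply/sumsmx_subP => i _.
by move/sub_kermxP: ker_full; rewrite mul1mx => /subr0_eq.
Qed.

(** The roots of det (a - lambda b) are the eigenvalues of b^{-1} a.  They need
    not be real, but commutation of real matrices can be tested over the
    complex numbers. *)
Lemma comm_mx_nonsingular_pencil (R : rcfType) (n : nat)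
    (a b Y Z : 'M[R]_n) (r : seq R[i]) :
  b \in unitmx -> uniq r -> size r = n ->
  (forall lambda, lambda \in r ->
     \det (map_mx (real_complex R) a - lambda *: map_mx (real_complex R) b)
     = 0) ->
  comm_mx (invmx b *m a) Y -> comm_mx (invmx b *m a) Z -> comm_mx Y Z.
Proof.
move=> b_unit r_uniq r_size r_root wY wZ.
pose toC := map_mx (real_complex R) : 'M[R]_n -> 'M[R[i]]_n.
have comm_toC X : comm_mx (invmx b *m a) X ->
    comm_mx (toC (invmx b *m a)) (toC X).
  by move=> wX; rewrite /comm_mx /toC -!map_mxM wX.
apply: (@map_mx_inj _ _ (real_complex R)); rewrite !map_mxM /=.
apply: comm_mx_simple_spectrum r_uniq r_size _ (comm_toC _ wY) (comm_toC _ wZ).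
move=> lambda /r_root /eqP /det0P [e e0 ker_e].
have bC_unit : toC b \in unitmx by rewrite map_unitmx.
(* If e a = lambda (e b), then e b is an eigenvector of b^{-1} a. *)
apply/eigenvalueP; exists (e *m toC b); last first.
  by apply: contraNneq e0 => eb0; rewrite -(mulmxK bC_unit e) eb0 mul0mx.
rewrite /toC map_mxM map_invmx -/(toC b) mulmxA mulmxK //.
by move/eqP: ker_e; rewrite mulmxBr subr_eq0 -scalemxAr => /eqP.
Qed.

Lemma comm_mx_invmx (F : comUnitRingType) (n : nat) (A B : 'M[F]_n) :
  B \in unitmx -> comm_mx A B -> comm_mx A (invmx B).
Proof.
move=> B_unit AB; apply: (can_inj (mulKmx B_unit)).
by rewrite mulmxA -AB mulmxK // mulKVmx.
Qed.

(** The product is Y^i w c Y^j g2^{-1} with Y^i = T^i g2, w = g2^{-1} g1 and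
    c = g^{-1} g2 = (l1 w + l2)^{-1}.  All four matrices commute with w, hence
    with each other, and i and j can be exchanged. *)
Lemma cross_term_sym (R : rcfType) (n : nat) (g1 g2 Ti Tj : 'M[R]_n)
    (l1 l2 : R) (r : seq R[i]) :
  g2 \in unitmx -> l1 *: g1 + l2 *: g2 \in unitmx ->
  uniq r -> size r = n ->
  (forall lambda, lambda \in r ->
     \det (map_mx (real_complex R) g1 - lambda *: map_mx (real_complex R) g2)
     = 0) ->
  g1 *m Ti *m g2 = g2 *m Ti *m g1 -> g1 *m Tj *m g2 = g2 *m Tj *m g1 ->
  Ti *m g1 *m invmx (l1 *: g1 + l2 *: g2) *m g2 *m Tj =
  Tj *m g1 *m invmx (l1 *: g1 + l2 *: g2) *m g2 *m Ti.
Proof.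
set g := l1 *: g1 + l2 *: g2.
move=> g2_unit g_unit r_uniq r_size r_root Ti_comm Tj_comm.
pose w := invmx g2 *m g1; pose c := invmx g *m g2.
have comm := comm_mx_nonsingular_pencil g2_unit r_uniq r_size r_root.
have wT X : g1 *m X *m g2 = g2 *m X *m g1 -> comm_mx w (X *m g2).
  move=> X_comm; rewrite /comm_mx /w -mulmxA mulmxA -[_ *m g1 *m _]mulmxA.
  by rewrite [g1 *m _]mulmxA X_comm !mulmxA mulVmx // mul1mx mulmxK.
have c_unit : c \in unitmx by rewrite unitmx_mul unitmx_inv g_unit.
have w_c : comm_mx w c.
  have c_inv : invmx c = l1 *: w + l2%:M.
    apply: (can_inj (mulKmx c_unit)); rewrite mulmxV //.
    rewrite /c -mulmxA mulmxDr -scalemxAr /w mulKVmx // mul_mx_scalar.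
    by rewrite -/g mulVmx.
  have wV : comm_mx w (invmx c).
    rewrite c_inv /comm_mx mulmxDr mulmxDl -scalemxAl -scalemxAr.
    by rewrite mul_mx_scalar mul_scalar_mx.
  by rewrite -(invmxK c); apply: comm_mx_invmx; rewrite ?unitmx_inv.
have split_product A B : A *m g1 *m invmx g *m g2 *m B =
    (A *m g2) *m (w *m c) *m (B *m g2) *m invmx g2.
  by rewrite /w /c !mulmxA mulmxK // mulmxK.
rewrite !split_product; congr (_ *m _).
have swap A B K : comm_mx A K -> comm_mx B K -> comm_mx A B ->
    A *m K *m B = B *m K *m A.
  by move=> AK BK AB; rewrite AK BK -!mulmxA AB.
have comm_wc X : comm_mx w X -> comm_mx X (w *m c).
  by move=> wX; apply: comm_mxM; [exact: comm_mx_sym | exact: comm].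
by apply: swap; [apply: comm_wc | apply: comm_wc | apply: comm]; apply: wT.
Qed.

(** * Levi-Civita coefficients at a point *)

Lemma invmx_sym (F : comUnitRingType) (n : nat) (A : 'M[F]_n) :
  A^T = A -> (invmx A)^T = invmx A.
Proof. by move=> A_sym; rewrite trmx_inv A_sym. Qed.

Lemma mx_lincombE (R : pzRingType) m n (a b : R) (A B : 'M[R]_(m, n)) i j :
  (a *: A + b *: B) i j = a * A i j + b * B i j.
Proof. by rewrite !mxE. Qed.

Lemma mx_subE (V : zmodType) m n (A B : 'M[V]_(m, n)) i j :
  (A - B) i j = A i j - B i j.
Proof. by rewrite !mxE. Qed.

Section PointwiseAlgebra.
Variables (R : realFieldType) (N : nat).
Implicit Types (g h v B : 'M[R]_N) (C T d : 'I_N -> 'M[R]_N).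

(** A family C stands for coefficients C^i_{jk}: C i is the matrix in the two
    lower indices, [last_slice C k] the one in the upper index and the first
    lower index, that is, the connection matrix in the direction k. *)
Definition last_slice C (k : 'I_N) : 'M[R]_N := \matrix_(i, j) C i j k.

(** The pointwise content of being the Levi-Civita connection of g, when d k
    is the derivative of the contravariant metric in the direction k: no
    torsion, and nabla_k g^{ij} = 0. *)
Definition levi_civita_at g d C : Prop :=
  (forall i, (C i)^T = C i) /\
  (forall k, d k = - (last_slice C k *m g + g *m (last_slice C k)^T)).

(** The matrix g C^j has the entries Gamma^{ij}_k; this is the rule
    d_k g^{ij} = - (Gamma^{ij}_k + Gamma^{ji}_k). *)
Lemma metric_derivative_entry g C k i j : g^T = g ->
  (- (last_slice C k *m g + g *m (last_slice C k)^T)) i j =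
  - ((g *m C i) j k + (g *m C j) i k).
Proof.
move=> g_sym; rewrite [LHS]mxE [X in - X]mxE; congr (- (_ + _)).
  rewrite -{1}g_sym -{1}[last_slice C k]trmxK -trmx_mul !mxE.
  by apply: eq_bigr => s _; rewrite !mxE.
by rewrite !mxE; apply: eq_bigr => s _; rewrite !mxE.
Qed.

(** Six alternating uses of the two symmetries bring the indices back to
    their place with the opposite sign. *)
Lemma skew_sym_zero (a : 'I_N -> 'I_N -> 'I_N -> R) :
  (forall i j k, a i j k = a i k j) -> (forall i j k, a i j k = - a j i k) ->
  forall i j k, a i j k = 0.
Proof.
move=> sym skew i j k.
have : a i j k = - a i j k.
  by rewrite [LHS]sym skew sym [X in - X]skew opprK sym [LHS]skew.
lra.
Qed.

(** With all indices raised, the difference of two solutions is symmetric in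
    one pair of indices and skew in an overlapping one. *)
Lemma levi_civita_unique g d C C' : g^T = g -> g \in unitmx ->
  levi_civita_at g d C -> levi_civita_at g d C' -> forall i, C i = C' i.
Proof.
move=> g_sym g_unit [C_sym dC] [C'_sym dC'] i.
pose D j := C j - C' j.
have D_sym j : (D j)^T = D j by rewrite /D linearB /= C_sym C'_sym.
have D_skew k : last_slice D k *m g + g *m (last_slice D k)^T = 0.
  have -> : last_slice D k = last_slice C k - last_slice C' k.
    by apply/matrixP => a b; rewrite !mxE.
  rewrite linearB /= mulmxBl mulmxBr addrACA -opprD.
  by apply/eqP; rewrite subr_eq0 -eqr_opp -dC -dC'.
have lowered_slice j k b : (g *m D k *m g) j b =
    \sum_s (g *m D k) j s * g s b by rewrite mxE.
have W0 : forall k j b, (g *m D k *m g) j b = 0.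
  apply: skew_sym_zero => k j b.
    have : (g *m D k *m g)^T = g *m D k *m g.
      by rewrite !trmx_mul g_sym D_sym mulmxA.
    by move=> /matrixP/(_ b j); rewrite mxE.
  rewrite !lowered_slice -sumrN; apply: eq_bigr => s _.
  rewrite -mulNr; congr (_ * _); apply/eqP; rewrite -addr_eq0 -oppr_eq0 addrC.
  by rewrite -metric_derivative_entry // D_skew oppr0 mxE.
have /eqP : D i = 0.
  rewrite -(mulKmx g_unit (D i)) -(mulmxK g_unit (g *m D i)).
  have -> : g *m D i *m g = 0 by apply/matrixP => j b; rewrite W0 mxE.
  by rewrite mul0mx mulmx0.
by rewrite subr_eq0 => /eqP.
Qed.

Section Pencil.
Variables (g1 g2 : 'M[R]_N) (d1 d2 C1 C2 : 'I_N -> 'M[R]_N).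
Hypotheses (g1_sym : g1^T = g1) (g2_sym : g2^T = g2).
Hypotheses (LC1 : levi_civita_at g1 d1 C1) (LC2 : levi_civita_at g2 d2 C2).

Let T p := C1 p - C2 p.

Lemma difference_sym p : (T p)^T = T p.
Proof. by rewrite /T linearB /= LC1.1 LC2.1. Qed.

(** The left side is the torsion of l1 Gamma_1 + l2 Gamma_2 with respect to
    l1 g1 + l2 g2.  Its l1^2 and l2^2 terms are the torsions of the two
    connections with respect to their own metrics; only the mixed term
    survives. *)
Lemma pencil_torsion l1 l2 p :
  let X := l1 *: (g1 *m C1 p) + l2 *: (g2 *m C2 p) in
  let g := l1 *: g1 + l2 *: g2 in
  X *m g - (X *m g)^T = (l1 * l2) *: (g1 *m T p *m g2 - g2 *m T p *m g1).
Proof.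
move=> X g.
have tr a b c : (a *m b *m c)^T = c^T *m b^T *m a^T :> 'M[R]_N.
  by rewrite !trmx_mul mulmxA.
rewrite /X /g /T !(mulmxDr, mulmxDl, mulmxBr, mulmxBl) -!scalemxAl -!scalemxAr.
rewrite !(linearD, linearZ) /= !tr g1_sym g2_sym LC1.1 LC2.1.
rewrite !(mulmxN, mulNmx).
by apply/matrixP => i j; rewrite !mxE; ring.
Qed.

(** Metric compatibility is linear in the pair (metric, coefficients with
    upper indices), so the linear combination of the connections satisfies it
    for the combined metric; self-adjointness removes the torsion, and
    uniqueness does the rest. *)
Lemma pencil_connection_of_self_adjoint l1 l2 C :
  let g := l1 *: g1 + l2 *: g2 in
  g \in unitmx ->
  levi_civita_at g (fun k => l1 *: d1 k + l2 *: d2 k) C ->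
  (forall p, g1 *m T p *m g2 = g2 *m T p *m g1) ->
  forall p, g *m C p = l1 *: (g1 *m C1 p) + l2 *: (g2 *m C2 p).
Proof.
move=> g g_unit LC T_comm.
have g_sym : g^T = g by rewrite /g linearD !linearZ /= g1_sym g2_sym.
pose X p := l1 *: (g1 *m C1 p) + l2 *: (g2 *m C2 p).
pose C' p := invmx g *m X p.
have gC' p : g *m C' p = X p by rewrite mulKVmx.
suff LC' : levi_civita_at g (fun k => l1 *: d1 k + l2 *: d2 k) C'.
  by move=> p; rewrite (levi_civita_unique g_sym g_unit LC LC') gC'.
split=> [p|k].
  have gC'g_sym : (X p *m g)^T = X p *m g.
    apply/eqP; rewrite eq_sym -subr_eq0 pencil_torsion T_comm subrr scaler0.
    by [].
  have -> : C' p = invmx g *m (X p *m g) *m invmx g.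
    by rewrite -mulmxA mulmxK.
  by rewrite 2!trmx_mul trmx_inv g_sym gC'g_sym mulmxA.
apply/matrixP => i j; rewrite metric_derivative_entry // !gC'.
rewrite mxE [X in X + _]mxE [X in _ + X]mxE LC1.2 LC2.2.
by rewrite !metric_derivative_entry // !mxE; ring.
Qed.

Lemma self_adjoint_of_pencil_connection l1 l2 C :
  let g := l1 *: g1 + l2 *: g2 in
  l1 * l2 != 0 -> (forall p, (C p)^T = C p) ->
  (forall p, g *m C p = l1 *: (g1 *m C1 p) + l2 *: (g2 *m C2 p)) ->
  forall p, g1 *m T p *m g2 = g2 *m T p *m g1.
Proof.
move=> g l12 C_sym gC p; apply/eqP; rewrite -subr_eq0.
have g_sym : g^T = g by rewrite /g linearD !linearZ /= g1_sym g2_sym.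
have := pencil_torsion l1 l2 p; rewrite /= -gC -/g !trmx_mul g_sym C_sym mulmxA.
by move/eqP; rewrite subrr eq_sym scaler_eq0 (negPf l12).
Qed.

(** Expand C = C2 + l1 g^{-1} g1 T.  All terms containing C2 agree on both
    sides, and the terms without it are l1 T g1 (l1 g^{-1} g1 - 1) T, where
    l1 g1 - g = - l2 g2. *)
Lemma pencil_curvature_quadratic l1 l2 C :
  let g := l1 *: g1 + l2 *: g2 in
  g \in unitmx -> (forall p, (C p)^T = C p) ->
  (forall p, g *m C p = l1 *: (g1 *m C1 p) + l2 *: (g2 *m C2 p)) ->
  forall i j, C i *m g *m C j =
    l1 *: (C1 i *m g1 *m C1 j) + l2 *: (C2 i *m g2 *m C2 j)
    - (l1 * l2) *: (T i *m g1 *m invmx g *m g2 *m T j).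
Proof.
move=> g g_unit C_sym gC i j.
have g_sym : g^T = g by rewrite /g linearD !linearZ /= g1_sym g2_sym.
have gCT p : g *m C p = g *m C2 p + l1 *: (g1 *m T p).
  rewrite gC /g /T mulmxBr mulmxDl -!scalemxAl.
  by apply/matrixP => a b; rewrite !mxE; ring.
have CgT p : C p *m g = C2 p *m g + l1 *: (T p *m g1).
  apply: trmx_inj; rewrite trmx_mul [RHS]linearD [X in _ + X]linearZ /=.
  rewrite !trmx_mul g_sym g1_sym.
  by rewrite C_sym difference_sym LC2.1 gCT.
have CT p : C p = C2 p + l1 *: (invmx g *m g1 *m T p).
  by rewrite -[LHS](mulKmx g_unit) gCT mulmxDr mulKmx // -scalemxAr mulmxA.
have g2E : l2 *: g2 = g - l1 *: g1 by rewrite /g addrAC subrr add0r.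
have C1E p : C1 p = C2 p + T p by rewrite /T addrC subrK.
clearbody g.
have -> : (l1 * l2) *: (T i *m g1 *m invmx g *m g2 *m T j) =
    l1 *: (T i *m g1 *m T j)
    - (l1 * l1) *: (T i *m g1 *m invmx g *m g1 *m T j).
  move: (T i) (T j) => Ti Tj.
  rewrite -scalerA [l2 *: _]scalemxAl [l2 *: _]scalemxAr g2E.
  rewrite mulmxBr mulmxKV // mulmxBl.
  by rewrite scalerBr -scalemxAr -scalemxAl scalerA.
rewrite {1}CgT CT !C1E; move: (T i) (T j) => Ti Tj.
have -> : l2 *: (C2 i *m g2 *m C2 j) =
    C2 i *m g *m C2 j - l1 *: (C2 i *m g1 *m C2 j).
  by rewrite scalemxAl scalemxAr g2E mulmxBr mulmxBl -scalemxAr -scalemxAl.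
rewrite !(mulmxDr, mulmxDl) -!scalemxAl -!scalemxAr !mulmxA.
rewrite mulmxK //.
by apply/matrixP => a b; rewrite !mxE; ring.
Qed.

End Pencil.
End PointwiseAlgebra.

(** * The Nijenhuis tensor at a point *)

Section PointwiseNijenhuis.
Variables (R : realFieldType) (N : nat).
Implicit Types (g h v A B : 'M[R]_N) (C : 'I_N -> 'M[R]_N).

(** The five contraction rules below rewrite sums over connection matrices as
    entries of products with the matrices C p, where the symmetry in the lower
    indices can be used. *)
Lemma slice_mul_entry C A B k i j :
  \sum_s A s i * (last_slice C s *m B) k j = (B^T *m C k *m A) j i.
Proof.
rewrite mxE; apply: eq_bigr => s _; rewrite mulrC !mxE; congr (_ * _).
by apply: eq_bigr => p _; rewrite !mxE mulrC.
Qed.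

Lemma mul_slice_entry C A B k i j :
  \sum_s A s i * (B *m last_slice C s) k j = \sum_p B k p * (C p *m A) j i.
Proof.
under eq_bigr => s _ do rewrite mxE mulr_sumr.
rewrite exchange_big; apply: eq_bigr => p _; rewrite mxE mulr_sumr.
by apply: eq_bigr => s _; rewrite !mxE; ring.
Qed.

Lemma slice_between_entry C A B k i j :
  (B *m last_slice C j *m A) k i = \sum_s B k s * (A^T *m C s) i j.
Proof.
rewrite -mulmxA mxE; apply: eq_bigr => s _; rewrite !mxE; congr (_ * _).
by apply: eq_bigr => p _; rewrite !mxE mulrC.
Qed.

Lemma trslice_sum_entry C g h A k i j :
  \sum_s A s i * (g *m (last_slice C s)^T *m h) k j =
  \sum_t g k t * \sum_p (C p *m A) t i * h p j.
Proof.
under eq_bigr => s _ do rewrite -mulmxA mxE mulr_sumr.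
rewrite exchange_big; apply: eq_bigr => t _.
transitivity (g k t * \sum_s A s i * ((last_slice C s)^T *m h) t j).
  by rewrite mulr_sumr; apply: eq_bigr => s _; ring.
congr (_ * _); under eq_bigr => s _ do rewrite mxE mulr_sumr.
rewrite exchange_big; apply: eq_bigr => p _; rewrite mxE mulr_suml.
by apply: eq_bigr => s _; rewrite !mxE; ring.
Qed.

Lemma trslice_between_entry C g h A k i j :
  (g *m A^T *m (last_slice C j)^T *m h) k i =
  \sum_t g k t * \sum_p (A^T *m C p) t j * h p i.
Proof.
rewrite -!mulmxA mxE; apply: eq_bigr => t _; congr (_ * _).
rewrite mulmxA mxE; apply: eq_bigr => p _; rewrite !mxE; congr (_ * _).
by apply: eq_bigr => s _; rewrite !mxE.
Qed.

Variables (g1 g2 : 'M[R]_N) (d1 d2 C1 C2 : 'I_N -> 'M[R]_N).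
Hypotheses (g1_sym : g1^T = g1) (g2_sym : g2^T = g2).
Hypotheses (g1_unit : g1 \in unitmx) (g2_unit : g2 \in unitmx).
Hypotheses (LC1 : levi_civita_at g1 d1 C1) (LC2 : levi_civita_at g2 d2 C2).

Let h := invmx g2.
Let v := g1 *m h.
Let T p := C1 p - C2 p.
Let dv s := d1 s *m h - v *m d2 s *m h.
Let Z p := T p *m v - v^T *m T p.
Let nij k i j := \sum_s (v s i * dv s k j - v s j * dv s k i
                         + v k s * dv j s i - v k s * dv i s j).

Let h_sym : h^T = h. Proof. exact: invmx_sym. Qed.

(** Up to sign, the first two terms are the covariant derivative of v for the
    second connection: g2 is parallel, and the derivative of g1 only sees
    T. *)
Lemma affinor_derivative_connection s :
  dv s = - (last_slice T s *m v) - g1 *m (last_slice T s)^T *m h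
         - last_slice C2 s *m v + v *m last_slice C2 s.
Proof.
have TE : last_slice T s = last_slice C1 s - last_slice C2 s.
  by apply/matrixP => i j; rewrite !mxE.
rewrite /dv LC1.2 LC2.2 {}TE linearB /=.
move: (last_slice C1 s) (last_slice C2 s) => E1 E2.
have vg : v *m g2 = g1 by rewrite /v mulmxKV.
have -> : v *m - (E2 *m g2 + g2 *m E2^T) *m h = - (v *m E2 + g1 *m E2^T *m h).
  by rewrite mulmxN mulNmx mulmxDr mulmxDl !mulmxA mulmxK // vg.
rewrite mulNmx mulmxDl mulmxBr !mulmxBl -!mulmxA -/v.
by apply/matrixP => i j; rewrite !mxE; ring.
Qed.

(** The Nijenhuis tensor is this half skewed in (i, j).  The factors are
    arranged so that the terms symmetric in (i, j) are visible, and the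
    remaining ones all carry g1 on the upper index, which uses
    v g1 = g1 v^T. *)
Lemma nijenhuis_half k i j :
  \sum_s (v s i * dv s k j + v k s * dv j s i) =
  - (v^T *m T k *m v) j i - (v^T *m C2 k *m v) j i
  + \sum_p (v *m v) k p * C2 p i j
  - \sum_t g1 k t * (\sum_p (T p *m v) t i * h p j
      + \sum_p (v^T *m T p) t j * h p i + \sum_p h t p * (T p *m v) j i).
Proof.
have vT : v^T = h *m g1 by rewrite /v trmx_mul h_sym g1_sym.
have T_sym p : (T p)^T = T p by exact: difference_sym LC1 LC2 p.
have flip C p : (C p)^T = C p -> (v^T *m C p) i j = (C p *m v) j i.
  by move=> C_sym; rewrite -{1}C_sym -trmx_mul mxE.
rewrite big_split /=.
have -> : \sum_s v s i * dv s k j =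
    - (\sum_s v s i * (last_slice T s *m v) k j)
    - \sum_s v s i * (g1 *m (last_slice T s)^T *m h) k j
    - \sum_s v s i * (last_slice C2 s *m v) k j
    + \sum_s v s i * (v *m last_slice C2 s) k j.
  rewrite -!sumrN -!big_split /=; apply: eq_bigr => s _.
  by rewrite affinor_derivative_connection !mxE; ring.
have -> : \sum_s v k s * dv j s i =
    - (v *m last_slice T j *m v) k i
    - (g1 *m v^T *m (last_slice T j)^T *m h) k i
    - (v *m last_slice C2 j *m v) k i
    + (v *m v *m last_slice C2 j) k i.
  transitivity ((v *m dv j) k i); first by rewrite mxE.
  have -> : g1 *m v^T = v *m g1 by rewrite vT /v mulmxA.
  rewrite affinor_derivative_connection !(mulmxDr, mulmxN) !mulmxA.
  by rewrite !mxE; ring.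
rewrite !slice_mul_entry mul_slice_entry trslice_sum_entry.
rewrite !slice_between_entry trslice_between_entry.
have -> : (v *m v *m last_slice C2 j) k i = \sum_p (v *m v) k p * C2 p i j.
  by rewrite mxE; apply: eq_bigr => p _; rewrite [last_slice _ _ _ _]mxE.
have -> : \sum_s v k s * (v^T *m C2 s) i j = \sum_s v k s * (C2 s *m v) j i.
  by apply: eq_bigr => s _; rewrite flip ?LC2.1.
have -> : \sum_s v k s * (v^T *m T s) i j =
    \sum_t g1 k t * \sum_p h t p * (T p *m v) j i.
  under [RHS]eq_bigr => t _ do rewrite mulr_sumr.
  rewrite exchange_big; apply: eq_bigr => s _ /=.
  rewrite flip // {1}/v mxE mulr_suml.
  by apply: eq_bigr => t _; rewrite mulrA.
under [X in _ = _ - X]eq_bigr => t _ do rewrite !mulrDr.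
by rewrite !big_split /=; ring.
Qed.

Lemma nijenhuis_connection k i j :
  nij k i j = - \sum_t g1 k t * (\sum_p h j p * Z p t i
    - \sum_p h i p * Z p t j + \sum_p h t p * Z p j i).
Proof.
have T_sym p : (T p)^T = T p by exact: difference_sym LC1 LC2 p.
have flip p a b : (v^T *m T p) a b = (T p *m v) b a.
  by rewrite -{1}T_sym -trmx_mul mxE.
have hE a b : h a b = h b a by rewrite -{1}h_sym mxE.
have sym3 A B : B^T = B -> (A^T *m B *m A) i j = (A^T *m B *m A) j i.
  move=> B_sym; have : (A^T *m B *m A)^T = A^T *m B *m A.
    by rewrite !trmx_mul trmxK B_sym mulmxA.
  by move=> /matrixP/(_ j i); rewrite mxE.
transitivity (\sum_s (v s i * dv s k j + v k s * dv j s i)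
              - \sum_s (v s j * dv s k i + v k s * dv i s j)).
  by rewrite -sumrN -big_split; apply: eq_bigr => s _ /=; ring.
rewrite !nijenhuis_half !(sym3 v) ?LC2.1 //.
have -> : \sum_p (v *m v) k p * C2 p j i = \sum_p (v *m v) k p * C2 p i j.
  apply: eq_bigr => p _.
  by move/matrixP: (LC2.1 p) => /(_ i j); rewrite mxE => ->.
set S1 := \sum_t g1 k t * _; set S2 := \sum_t g1 k t * _.
suff -> : \sum_t g1 k t * (\sum_p h j p * Z p t i
    - \sum_p h i p * Z p t j + \sum_p h t p * Z p j i) = S1 - S2 by ring.
rewrite /S1 /S2 -sumrN -big_split; apply: eq_bigr => t _ /=.
rewrite -mulrBr; congr (_ * _).
rewrite -!sumrN -!big_split -!sumrN -!big_split; apply: eq_bigr => p _ /=.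
rewrite /Z !mxE.
rewrite (hE j p) (hE i p) -[LHS]/(h p j * _ - _ + _).
by have := (flip p j i); rewrite !mxE => ->; ring.
Qed.

(** By skewness the three cyclic instances of the relation read b + c = a,
    c + a = b and a + b = c. *)
Lemma cyclic_zero (z : 'I_N -> 'I_N -> 'I_N -> R) :
  (forall j t i, z j t i = - z j i t) ->
  (forall t i j, z j t i - z i t j + z t j i = 0) ->
  forall j t i, z j t i = 0.
Proof.
move=> skew cyc j t i.
have := (cyc t i j, cyc i j t, cyc j t i).
rewrite (skew i t j) (skew t j i) (skew j i t) => -[[]]; lra.
Qed.

(** g1 and then g2^{-1} are cancelled from [nijenhuis_connection]: the
    bracket is the cyclic expression in Z with its upper index lowered by
    g2. *)
Lemma nijenhuis_zero_iff_self_adjoint :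
  (forall k i j, nij k i j = 0) <->
  (forall p, g1 *m T p *m g2 = g2 *m T p *m g1).
Proof.
have T_sym p : (T p)^T = T p by exact: difference_sym LC1 LC2 p.
have vT : v^T = h *m g1 by rewrite /v trmx_mul h_sym g1_sym.
have ZE p : g2 *m Z p *m g2 = g2 *m T p *m g1 - g1 *m T p *m g2.
  rewrite /Z vT /v mulmxBr mulmxBl !mulmxA mulmxKV // mulmxV // mul1mx.
  by [].
split=> [nij0 p|T_comm k i j]; last first.
  have Z0 p : Z p = 0.
    rewrite -(mulKmx g2_unit (Z p)) -(mulmxK g2_unit (g2 *m Z p)) ZE.
    by rewrite T_comm subrr mul0mx mulmx0.
  rewrite nijenhuis_connection big1 ?oppr0 // => t _.
  by rewrite !big1 ?subrr ?addr0 ?mulr0 // => p _; rewrite Z0 mxE mulr0.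
pose z j t i := \sum_p h j p * Z p t i.
have z_skew j t i : z j t i = - z j i t.
  rewrite /z -sumrN; apply: eq_bigr => q _; rewrite -mulrN; congr (_ * _).
  have Z_skew : Z q = - (Z q)^T.
    rewrite /Z; move: v (T q) (T_sym q) => A B B_sym.
    by rewrite linearB /= !trmx_mul trmxK B_sym opprB.
  by rewrite {1}Z_skew mxE [X in - X]mxE.
have z_cyc t i j : z j t i - z i t j + z t j i = 0.
  pose c := \col_t (z j t i - z i t j + z t j i).
  have : g1 *m c = 0.
    apply/matrixP => k a; rewrite mxE [RHS]mxE; apply: oppr_inj.
    rewrite oppr0 -[RHS](nij0 k i j) nijenhuis_connection; congr (- _).
    by apply: eq_bigr => q _; rewrite mxE.
  move/(congr1 (mulmx (invmx g1))); rewrite mulKmx // mulmx0.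
  by move/matrixP => /(_ t ord0); rewrite mxE [RHS]mxE.
have z0 := cyclic_zero z_skew z_cyc.
suff Zp0 : Z p = 0.
  by apply/eqP; rewrite eq_sym -subr_eq0 -ZE Zp0 mulmx0 mul0mx.
apply/matrixP => t i; rewrite [RHS]mxE.
pose c := \col_q Z q t i.
have : h *m c = 0.
  apply/matrixP => j a; rewrite [RHS]mxE -[RHS](z0 j t i) mxE.
  by apply: eq_bigr => q _; rewrite mxE.
move/(congr1 (mulmx g2)); rewrite mulKVmx // mulmx0.
by move/matrixP => /(_ p ord0); rewrite mxE [RHS]mxE.
Qed.

End PointwiseNijenhuis.

(** * Partial derivatives of functions and matrix fields *)

(** A determinant is a polynomial in the entries, so it inherits continuity
    and existence of partial derivatives alike. *)
Lemma det_closed (T : Type) (R : comPzRingType) (n : nat)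
    (P : (T -> R) -> Prop) (A : T -> 'M[R]_n) :
  (forall c, P (fun=> c)) ->
  (forall f g, P f -> P g -> P (fun x => f x + g x)) ->
  (forall f g, P f -> P g -> P (fun x => f x * g x)) ->
  (forall i j, P (fun x => A x i j)) -> P (fun x => \det (A x)).
Proof.
move=> Pc PD PM PA.
have Psum (I : Type) (r : seq I) (F : I -> T -> R) : (forall i, P (F i)) ->
    P (fun x => \sum_(i <- r) F i x).
  move=> PF; elim: r => [|i r IHr].
    by under [X in P X]eq_fun do rewrite big_nil.
  by under [X in P X]eq_fun do rewrite big_cons; apply: PD.
have Pprod (I : Type) (r : seq I) (F : I -> T -> R) : (forall i, P (F i)) ->
    P (fun x => \prod_(i <- r) F i x).
  move=> PF; elim: r => [|i r IHr].
    by under [X in P X]eq_fun do rewrite big_nil.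
  by under [X in P X]eq_fun do rewrite big_cons; apply: PM.
by apply: Psum => s; apply: PM => //; apply: Pprod.
Qed.

Lemma continuous_at_det (T : topologicalType) (R : realType) (n : nat)
    (A : T -> 'M[R]_n) (t : T) :
  (forall i j, {for t, continuous (fun x => A x i j)}) ->
  {for t, continuous (fun x => \det (A x))}.
Proof.
move=> A_cont.
suff : (fun f : T -> R => {for t, continuous f}) (fun x => \det (A x)) by [].
apply: det_closed => [c|f g|f g|//].
- exact: cvg_cst.
- exact: continuousD.
- exact: continuousM.
Qed.

Section PartialDerivatives.
Variables (R : realType) (N : nat).
Implicit Types (f h : 'rV[R]_N -> R) (u : 'rV[R]_N).

(** Existence of partial derivatives suffices for all the rules used below,
    since only one direction enters at a time. *)
Definition has_partials f u := forall k : 'I_N, derivable f u (delta_mx 0 k).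

Lemma has_partials_cst c u : has_partials (fun=> c) u.
Proof. by move=> k; exact: derivable_cst. Qed.

Lemma has_partialsD f h u : has_partials f u -> has_partials h u ->
  has_partials (fun w => f w + h w) u.
Proof. by move=> Df Dh k; apply: (@derivableD _ _ _ f h). Qed.

Lemma has_partialsM f h u : has_partials f u -> has_partials h u ->
  has_partials (fun w => f w * h w) u.
Proof. by move=> Df Dh k; apply: (@derivableM _ _ f h). Qed.

Lemma has_partialsN f u : has_partials f u -> has_partials (fun w => - f w) u.
Proof. by move=> Df k; apply: (@derivableN _ _ _ f). Qed.

Lemma has_partialsV f u : f u != 0 -> has_partials f u ->
  has_partials (fun w => (f w)^-1) u.
Proof. by move=> f0 Df k; apply: derivableV. Qed.

Lemma has_partials_sum n (F : 'I_n -> 'rV[R]_N -> R) u :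
  (forall s, has_partials (F s) u) -> has_partials (fun w => \sum_s F s w) u.
Proof.
move=> DF k.
have -> : (fun w => \sum_s F s w) = \sum_s F s.
  by apply/funext => w; rewrite fct_sumE.
by apply: derivable_sum => s; apply: DF.
Qed.

Lemma partialD k f h u : has_partials f u -> has_partials h u ->
  partial k (fun w => f w + h w) u = partial k f u + partial k h u.
Proof. by move=> Df Dh; apply: (@deriveD _ _ _ f h). Qed.

Lemma partialM k f h u : has_partials f u -> has_partials h u ->
  partial k (fun w => f w * h w) u = partial k f u * h u + f u * partial k h u.
Proof.
move=> Df Dh; transitivity (f u *: partial k h u + h u *: partial k f u).
  exact: (@deriveM _ _ f h).
by rewrite /GRing.scale /=; ring.
Qed.

Lemma partialZ k c f u : has_partials f u ->
  partial k (fun w => c * f w) u = c * partial k f u.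
Proof. by move=> Df; apply: (@deriveZ _ _ _ f c). Qed.

Lemma has_partials_lincomb a b f h u : has_partials f u -> has_partials h u ->
  has_partials (fun w => a * f w + b * h w) u.
Proof.
by move=> Df Dh; apply: has_partialsD; apply: has_partialsM => //;
  exact: has_partials_cst.
Qed.

Lemma partial_lincomb k a b f h u : has_partials f u -> has_partials h u ->
  partial k (fun w => a * f w + b * h w) u =
  a * partial k f u + b * partial k h u.
Proof.
move=> Df Dh; rewrite partialD ?partialZ //;
  by apply: has_partialsM => //; exact: has_partials_cst.
Qed.

Lemma partial_sum k n (F : 'I_n -> 'rV[R]_N -> R) u :
  (forall s, has_partials (F s) u) ->
  partial k (fun w => \sum_s F s w) u = \sum_s partial k (F s) u.
Proof.
move=> DF; rewrite /partial.
have -> : (fun w => \sum_s F s w) = \sum_s F s.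
  by apply/funext => w; rewrite fct_sumE.
by apply: derive_sum => s; apply: DF.
Qed.

Section LocalEquality.
Variables (U : set 'rV[R]_N) (f h : 'rV[R]_N -> R) (u : 'rV[R]_N).
Hypotheses (openU : open U) (Uu : U u) (fh : forall w, U w -> f w = h w).

Lemma near_eq_on_open : \near u, f u = h u.
Proof. by apply: filterS fh _; apply: open_nbhs_nbhs. Qed.

Lemma partial_ext k : partial k f u = partial k h u.
Proof. exact: near_eq_derive near_eq_on_open. Qed.

Lemma has_partials_ext : has_partials f u -> has_partials h u.
Proof.
by move=> Df k; apply: near_eq_derivable near_eq_on_open _; apply: Df.
Qed.

End LocalEquality.

Lemma smooth_on_continuous (U : set 'rV[R]_N) f u : smooth_on U f -> U u ->
  {for u, continuous f}.
Proof. by move=> sf Uu; have [] := sf [::] u Uu. Qed.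

Lemma smooth_on_has_partials (U : set 'rV[R]_N) f u : smooth_on U f -> U u ->
  has_partials f u.
Proof. by move=> sf Uu; have [] := sf [::] u Uu. Qed.

Lemma smooth_on_partial (U : set 'rV[R]_N) f i : smooth_on U f ->
  smooth_on U (partial i f).
Proof.
by move=> sf s u Uu; have := sf (rcons s i) u Uu; rewrite foldr_rcons.
Qed.

(** Iterated partial derivatives are linear at every point of an open set,
    by induction: equality on the open set lets one differentiate once
    more. *)
Lemma smooth_on_linear (U : set 'rV[R]_N) a b f h : open U ->
  smooth_on U f -> smooth_on U h -> smooth_on U (fun w => a * f w + b * h w).
Proof.
move=> openU sf sh.
have partials s u : U u -> foldr partial (fun w => a * f w + b * h w) s u =
    a * foldr partial f s u + b * foldr partial h s u.
  elim: s u => //= i s IHs u Uu.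
  rewrite (partial_ext openU Uu IHs).
  have Df : has_partials (foldr partial f s) u by have [] := sf s u Uu.
  have Dh : has_partials (foldr partial h s) u by have [] := sh s u Uu.
  exact: partial_lincomb.
move=> s u Uu; have [cf Df] := sf s u Uu; have [ch Dh] := sh s u Uu.
split.
  rewrite /continuous_at /prop_for partials //; apply: cvg_trans.
    apply: near_eq_cvg; first exact: (@nbhs_filter _ u).
    apply: (near_eq_on_open openU Uu) => w Uw.
    by symmetry; exact: partials Uw.
  have c_cst (c : R) : {for u, continuous (fun _ : 'rV[R]_N => c)}.
    exact: cst_continuous.
  exact: (continuousD (continuousM (c_cst a) cf) (continuousM (c_cst b) ch)).
apply: (has_partials_ext openU Uu (fun w Uw => esym (partials s w Uw))).
exact: has_partials_lincomb.
Qed.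

End PartialDerivatives.

Section MatrixFields.
Variables (R : realType) (N : nat).
Implicit Types (A B : 'rV[R]_N -> 'M[R]_N) (u : 'rV[R]_N) (k : 'I_N).

Definition partial_mx k A u : 'M[R]_N :=
  \matrix_(i, j) partial k (fun w => A w i j) u.

Definition mx_has_partials A u :=
  forall i j, has_partials (fun w => A w i j) u.

Lemma mx_has_partialsM A B u : mx_has_partials A u -> mx_has_partials B u ->
  mx_has_partials (fun w => A w *m B w) u.
Proof.
move=> DA DB i j; under [X in has_partials X]eq_fun do rewrite mxE.
by apply: has_partials_sum => s; apply: has_partialsM.
Qed.

Lemma partial_mxM k A B u : mx_has_partials A u -> mx_has_partials B u ->
  partial_mx k (fun w => A w *m B w) u =
  partial_mx k A u *m B u + A u *m partial_mx k B u.
Proof.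
move=> DA DB; apply/matrixP => i j; rewrite !mxE.
under [X in partial k X]eq_fun do rewrite mxE.
rewrite partial_sum => [|s]; last exact: has_partialsM.
by rewrite -big_split; apply: eq_bigr => s _; rewrite partialM // !mxE.
Qed.

Lemma has_partials_det n (A : 'rV[R]_N -> 'M[R]_n) u :
  (forall i j, has_partials (fun w => A w i j) u) ->
  has_partials (fun w => \det (A w)) u.
Proof.
move=> DA.
apply: (@det_closed _ _ _ (fun f : 'rV[R]_N -> R => has_partials f u))
  => [c|f g|f g|//].
- exact: has_partials_cst.
- exact: has_partialsD.
- exact: has_partialsM.
Qed.

Lemma partial_mx_ext (U : set 'rV[R]_N) A B u k : open U -> U u ->
  (forall w, U w -> A w = B w) -> partial_mx k A u = partial_mx k B u.
Proof.
move=> openU Uu AB; apply/matrixP => i j; rewrite !mxE.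
by apply: (partial_ext openU Uu) => w Uw; rewrite AB.
Qed.

End MatrixFields.

(** * Christoffel symbols and curvature of a metric *)

Section Metric.
Variables (R : realType) (N : nat) (U : set 'rV[R]_N).
Variable (g : 'rV[R]_N -> 'M[R]_N).
Hypotheses (openU : open U) (metric_g : contravariant_metric U g).
Implicit Types (u : 'rV[R]_N) (i j k l : 'I_N).

Lemma metric_symmetric u : U u -> (g u)^T = g u.
Proof. by case: metric_g => _ + _; apply. Qed.

Lemma metric_unit u : U u -> g u \in unitmx.
Proof. by case: metric_g => _ _ nondeg Uu; rewrite unitmxE unitfE nondeg. Qed.

Lemma metric_has_partials u : U u -> mx_has_partials g u.
Proof.
by case: metric_g => smooth_g _ _ Uu i j; apply: smooth_on_has_partials Uu.
Qed.

Lemma partial_metric_has_partials k u : U u ->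
  mx_has_partials (partial_mx k g) u.
Proof.
case: metric_g => smooth_g _ _ Uu i j.
under [X in has_partials X]eq_fun do rewrite mxE.
by apply: smooth_on_has_partials Uu; apply: smooth_on_partial.
Qed.

(** Cramer's rule. *)
Lemma lower_has_partials u : U u -> mx_has_partials (lower g) u.
Proof.
move=> Uu i j.
pose cof w := (\det (g w))^-1 * cofactor (g w) j i.
have cofE w : U w -> cof w = lower g w i j.
  by move=> Uw; rewrite /lower /invmx metric_unit // !mxE.
apply: (has_partials_ext openU Uu cofE).
have Dg := metric_has_partials Uu.
apply: has_partialsM.
  apply: has_partialsV; first by case: metric_g => _ _; apply.
  exact: has_partials_det.
apply: has_partialsM; first exact: has_partials_cst.
apply: has_partials_det => a b.
under [X in has_partials X]eq_fun do rewrite !mxE.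
exact: Dg.
Qed.

(** Differentiate g g^{-1} = 1, which holds on the whole open set. *)
Lemma partial_lower k u : U u ->
  partial_mx k (lower g) u =
  - (lower g u *m partial_mx k g u *m lower g u).
Proof.
move=> Uu; have g_unit := metric_unit Uu.
have : partial_mx k (fun w => g w *m lower g w) u = 0.
  rewrite (@partial_mx_ext _ _ U _ (fun=> 1%:M)) // => [|w Uw]; last first.
    by rewrite /lower mulmxV ?metric_unit.
  by apply/matrixP => i j; rewrite !mxE; apply: derive_cst.
rewrite partial_mxM; [|exact: metric_has_partials|exact: lower_has_partials].
move/(congr1 (mulmx (lower g u))); rewrite mulmx0 mulmxDr mulKmx // mulmxA.
by move/eqP; rewrite addrC addr_eq0 => /eqP.
Qed.

Lemma partial_lower_has_partials k u : U u ->
  mx_has_partials (partial_mx k (lower g)) u.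
Proof.
move=> Uu i j.
apply: (has_partials_ext openU Uu (f := fun w =>
  - (lower g w *m partial_mx k g w *m lower g w) i j)) => [w Uw|].
  by rewrite partial_lower // [RHS]mxE.
apply: has_partialsN; apply: mx_has_partialsM; last exact: lower_has_partials.
apply: mx_has_partialsM; first exact: lower_has_partials.
exact: partial_metric_has_partials.
Qed.

Lemma partial_metric_sym k u : U u -> (partial_mx k g u)^T = partial_mx k g u.
Proof.
move=> Uu; apply/matrixP => i j; rewrite !mxE.
apply: (partial_ext openU Uu) => w Uw.
by move/matrixP: (metric_symmetric Uw) => /(_ i j); rewrite mxE.
Qed.

Lemma partial_lower_sym k u : U u ->
  (partial_mx k (lower g) u)^T = partial_mx k (lower g) u.
Proof.
move=> Uu; rewrite partial_lower // linearN /= !trmx_mul partial_metric_sym //.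
by rewrite /lower invmx_sym ?metric_symmetric // mulmxA.
Qed.

Lemma christoffel_has_partials i j k u : U u ->
  has_partials (christoffel g i j k) u.
Proof.
move=> Uu; have D2 l a b : has_partials (partial l (fun w => lower g w a b)) u.
  have := @partial_lower_has_partials l u Uu a b.
  by under [X in has_partials X]eq_fun do rewrite mxE.
apply: has_partialsM; first exact: has_partials_cst.
apply: has_partials_sum => s; apply: has_partialsM.
  exact: metric_has_partials.
apply: has_partialsD; first exact: has_partialsD.
exact: has_partialsN.
Qed.

Definition christoffel_mx i u : 'M[R]_N :=
  \matrix_(j, k) christoffel g i j k u.

Lemma christoffel_upE i j k u :
  christoffel_up g i j k u = (g u *m christoffel_mx j u) i k.
Proof. by rewrite mxE; apply: eq_bigr => s _; rewrite mxE. Qed.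

(** The connection matrix is g B_k, where the lowered symbols B_k satisfy
    B_k + B_k^T = d_k (g^{-1}); conjugating by g turns this into
    - d_k g. *)
Lemma christoffel_levi_civita u : U u ->
  levi_civita_at (g u) (fun k => partial_mx k g u) (christoffel_mx ^~ u).
Proof.
move=> Uu; pose H k := partial_mx k (lower g) u.
have HE k a b : partial k (fun w => lower g w a b) u = H k a b by rewrite mxE.
have H_sym k a b : H k a b = H k b a.
  by move/matrixP: (partial_lower_sym k Uu) => /(_ b a); rewrite mxE.
split=> [i|k].
  apply/matrixP => j k; rewrite !mxE /christoffel; congr (_ * _).
  apply: eq_bigr => s _; rewrite !HE; congr (_ * _).
  by rewrite (H_sym k s j) (H_sym j k s) (H_sym s k j) [H k j s + _]addrC.
pose B : 'M[R]_N := \matrix_(s, j) (2^-1 * (H j s k + H k j s - H s j k)).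
have EB : last_slice (christoffel_mx ^~ u) k = g u *m B.
  apply/matrixP => i j; rewrite mxE mxE [RHS]mxE /christoffel mulr_sumr.
  by apply: eq_bigr => s _; rewrite !HE [B _ _]mxE; ring.
have BH : B + B^T = H k.
  apply/matrixP => s j; rewrite mxE [B^T s j]mxE ![B _ _]mxE.
  by rewrite (H_sym k j s) (H_sym j s k) (H_sym s j k); lra.
rewrite EB trmx_mul metric_symmetric // mulmxA -mulmxDl -mulmxDr BH /H.
rewrite partial_lower // mulmxN mulNmx opprK -!mulmxA.
by rewrite mulVmx ?metric_unit // mulmx1 mulKVmx ?metric_unit.
Qed.

(** Moving g^{is} inside the derivatives of the Christoffel symbols costs
    (d_k g^{is}) Gamma^j_{sl}.  Metric compatibility splits this into two
    quadratic terms: one cancels the quadratic term of the curvature, the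
    other is the matrix product C^i g C^j. *)
Lemma curvature_upE i j k l u : U u ->
  curvature_up g i j k l u =
  partial l (christoffel_up g i j k) u - partial k (christoffel_up g i j l) u
  + ((christoffel_mx i u *m g u *m christoffel_mx j u) l k
     - (christoffel_mx j u *m g u *m christoffel_mx i u) l k).
Proof.
move=> Uu; have [C_sym dgE] := christoffel_levi_civita Uu.
pose CgC := christoffel_mx i u *m g u *m christoffel_mx j u.
have -> : (christoffel_mx j u *m g u *m christoffel_mx i u) l k = CgC k l.
  have : CgC^T = christoffel_mx j u *m g u *m christoffel_mx i u.
    by rewrite !trmx_mul !C_sym metric_symmetric // mulmxA.
  by move=> <-; rewrite mxE.
rewrite -/CgC.
set C := christoffel_mx ^~ u in C_sym dgE.
pose S a b := \sum_s g u i s *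
  \sum_p christoffel g j p a u * christoffel g p s b u.
pose P a b := \sum_s g u i s * partial a (christoffel g j s b) u.
have partial_up a b : partial a (christoffel_up g i j b) u =
    P a b - CgC a b - S b a.
  rewrite /christoffel_up partial_sum => [|s]; last first.
    apply: has_partialsM; first exact: metric_has_partials.
    exact: christoffel_has_partials.
  under eq_bigr => s _.
    rewrite partialM; [|exact: metric_has_partials
      |exact: christoffel_has_partials].
    over.
  rewrite big_split /= addrC -addrA -opprD; congr (_ + _).
  transitivity ((partial_mx a g u *m C j) i b).
    by rewrite [RHS]mxE; apply: eq_bigr => s _; rewrite !mxE.
  rewrite dgE mulNmx mxE mulmxDl mxE; congr (- (_ + _)).
    rewrite /CgC -!mulmxA !mxE; apply: eq_bigr => s _.
    by rewrite -[christoffel_mx i u]C_sym !mxE.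
  rewrite -mulmxA mxE; apply: eq_bigr => s _; congr (_ * _).
  by rewrite mxE; apply: eq_bigr => p _; rewrite !mxE mulrC.
rewrite !partial_up /curvature_up /curvature.
transitivity (- P k l + P l k - S k l + S l k).
  rewrite /S /P; under eq_bigr => s _ do rewrite !mulrDr !mulrN.
  by rewrite !big_split /= !sumrN.
move: (P k l) (P l k) (S k l) (S l k) (CgC k l) (CgC l k) => *.
by ring.
Qed.

End Metric.

(** * Pairs of metrics *)

(** Almost compatibility says something about T only if both coefficients of
    the combination are nonzero; small l keep the pencil nondegenerate at the
    point. *)
Lemma exists_nondegenerate_shift (R : realType) (n : nat) (a b : 'M[R]_n) :
  \det a != 0 -> exists2 l : R, l != 0 & \det (1 *: a + l *: b) != 0.
Proof.
move=> a0; pose f (l : R) := \det (1 *: a + l *: b).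
have f_cont : {for 0, continuous f}.
  apply: continuous_at_det => i j.
  have -> : (fun l : R => (1 *: a + l *: b) i j) =
      (fun l => 1 * a i j + l * b i j) by apply/funext => l; rewrite !mxE.
  apply: (@continuousD _ _ _ (fun _ : R => 1 * a i j) (fun l : R => l * b i j)).
    exact: cst_continuous.
  apply: (@continuousM _ _ (fun l : R => l) (fun _ : R => b i j)).
    exact: cvg_id.
  exact: cst_continuous.
have f0 : f 0 != 0 by rewrite /f scale1r scale0r addr0.
have near0 : \forall l \near (0 : R), f l != 0.
  apply: (f_cont [set y : R | y != 0]); apply: open_nbhs_nbhs; split => //.
have : \forall l \near (0 : R)^', l != 0 /\ f l != 0.
  near=> l; split; first by near: l; exact: nbhs_dnbhs_neq.
  by near: l; exact: nbhs_dnbhs.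
by move/filter_ex => [l [l0 fl]]; exists l.
Unshelve. all: by end_near.
Qed.

Section Pair.
Variables (R : realType) (N : nat) (U : set 'rV[R]_N).
Variables (g1 g2 : 'rV[R]_N -> 'M[R]_N).
Hypotheses (openU : open U).
Hypotheses (metric1 : contravariant_metric U g1).
Hypotheses (metric2 : contravariant_metric U g2).
Implicit Types (u : 'rV[R]_N) (l : R) (i j k p : 'I_N).

Definition connection_difference p u : 'M[R]_N :=
  christoffel_mx g1 p u - christoffel_mx g2 p u.

(** Multiplied by g2^{-1} on both sides, the relation becomes
    v^T T^p = T^p v for the affinor v = g1 g2^{-1}: v is self-adjoint for the
    bilinear form T^p. *)
Definition difference_self_adjoint u : Prop :=
  forall p, g1 u *m connection_difference p u *m g2 u =
            g2 u *m connection_difference p u *m g1 u.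

Lemma nijenhuis_zero_iff_difference_self_adjoint u : U u ->
  (forall k i j, nijenhuis (affinor g1 g2) k i j u = 0) <->
  difference_self_adjoint u.
Proof.
move=> Uu.
have LC1 := christoffel_levi_civita openU metric1 Uu.
have LC2 := christoffel_levi_civita openU metric2 Uu.
have iffN := nijenhuis_zero_iff_self_adjoint (metric_symmetric metric1 Uu)
  (metric_symmetric metric2 Uu) (metric_unit metric1 Uu)
  (metric_unit metric2 Uu) LC1 LC2.
have dvE s i j : partial s (fun w => affinor g1 g2 w i j) u =
    (partial_mx s g1 u *m invmx (g2 u)
     - g1 u *m invmx (g2 u) *m partial_mx s g2 u *m invmx (g2 u)) i j.
  transitivity (partial_mx s (affinor g1 g2) u i j); first by rewrite mxE.
  rewrite /affinor partial_mxM; [|exact: (metric_has_partials metric1)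
    |exact: (lower_has_partials openU metric2)].
  by rewrite (partial_lower openU metric2) // mulmxN !mulmxA.
split=> [nij0|comm k i j].
  apply/iffN => k i j; rewrite -[RHS](nij0 k i j) /nijenhuis.
  by apply: eq_bigr => s _; rewrite !dvE.
rewrite -[RHS](iffN.2 comm k i j) /nijenhuis.
by apply: eq_bigr => s _; rewrite !dvE.
Qed.

(** The pencil is a metric only here; being open, this set allows equalities
    between fields of the pencil to be differentiated. *)
Definition nondegenerate_locus (l1 l2 : R) :=
  U `&` [set u | \det (pencil g1 g2 l1 l2 u) != 0].

Lemma open_nondegenerate_locus (l1 l2 : R) : open (nondegenerate_locus l1 l2).
Proof.
rewrite openE => u [Uu du]; apply: filterI.
  exact: open_nbhs_nbhs.
have det_cont : {for u, continuous (fun w => \det (pencil g1 g2 l1 l2 w))}.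
  apply: continuous_at_det => i j.
  apply: (@smooth_on_continuous _ _ U) Uu.
  under [X in smooth_on _ X]eq_fun do rewrite !mxE.
  apply: smooth_on_linear openU _ _.
    by case: metric1.
  by case: metric2.
apply: (det_cont [set y : R | y != 0]); apply: open_nbhs_nbhs; split => //.
Qed.

Lemma pencil_metric (l1 l2 : R) :
  contravariant_metric (nondegenerate_locus l1 l2) (pencil g1 g2 l1 l2).
Proof.
split=> [i j|u [Uu _]|u []] //.
  have : smooth_on U (fun w => pencil g1 g2 l1 l2 w i j).
    under [X in smooth_on _ X]eq_fun do rewrite !mxE.
    apply: smooth_on_linear openU _ _.
      by case: metric1.
    by case: metric2.
  by move=> smooth_p s u [Uu _]; apply: smooth_p.
by rewrite /pencil linearD !linearZ /= !(metric_symmetric _ Uu).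
Qed.

Lemma pencil_levi_civita (l1 l2 : R) u : nondegenerate_locus l1 l2 u ->
  levi_civita_at (l1 *: g1 u + l2 *: g2 u)
    (fun k => l1 *: partial_mx k g1 u + l2 *: partial_mx k g2 u)
    (christoffel_mx (pencil g1 g2 l1 l2) ^~ u).
Proof.
move=> ru; have [C_sym dE] :=
  christoffel_levi_civita (@open_nondegenerate_locus l1 l2)
    (@pencil_metric l1 l2) ru.
split=> // k; rewrite -dE; apply/matrixP => i j; rewrite !mxE.
under [X in _ = partial k X _]eq_fun do rewrite !mxE.
case: ru => Uu _.
have D1 : has_partials (fun w => g1 w i j) u.
  exact: (metric_has_partials metric1).
have D2 : has_partials (fun w => g2 w i j) u.
  exact: (metric_has_partials metric2).
by rewrite partial_lincomb.
Qed.

Lemma connection_linear_of_self_adjoint (l1 l2 : R) u :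
  nondegenerate_locus l1 l2 u -> difference_self_adjoint u -> forall p,
  (l1 *: g1 u + l2 *: g2 u) *m christoffel_mx (pencil g1 g2 l1 l2) p u =
  l1 *: (g1 u *m christoffel_mx g1 p u) + l2 *: (g2 u *m christoffel_mx g2 p u).
Proof.
move=> ru comm; have [Uu du] := ru.
apply: (pencil_connection_of_self_adjoint (metric_symmetric metric1 Uu)
  (metric_symmetric metric2 Uu) (christoffel_levi_civita openU metric1 Uu)
  (christoffel_levi_civita openU metric2 Uu) _ (pencil_levi_civita ru) comm).
by rewrite unitmxE unitfE.
Qed.

Lemma almost_compatible_difference_self_adjoint u : U u ->
  almost_compatible U g1 g2 -> difference_self_adjoint u.
Proof.
move=> Uu ac.
have [l l0 dl] : exists2 l, l != 0 & \det (pencil g1 g2 1 l u) != 0.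
  by apply: exists_nondegenerate_shift; case: metric1 => _ _; apply.
have conn := ac 1 l (ex_intro2 _ _ u Uu dl) u Uu dl.
have [C_sym _] := pencil_levi_civita (conj Uu dl : nondegenerate_locus 1 l u).
apply: (self_adjoint_of_pencil_connection (l1 := 1) (l2 := l)
  (metric_symmetric metric1 Uu)
  (metric_symmetric metric2 Uu) (christoffel_levi_civita openU metric1 Uu)
  (christoffel_levi_civita openU metric2 Uu) _ C_sym).
  by rewrite mul1r.
move=> p; apply/matrixP => i k; have := conn i p k.
by rewrite !christoffel_upE => ->; rewrite mx_lincombE.
Qed.

Lemma nijenhuis_almost_compatible :
  nijenhuis_vanishes U (affinor g1 g2) -> almost_compatible U g1 g2.
Proof.
move=> nij0 l1 l2 _ u Uu du i j k.
have comm := (nijenhuis_zero_iff_difference_self_adjoint Uu).1 (nij0 u Uu).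
have := connection_linear_of_self_adjoint
  (conj Uu du : nondegenerate_locus l1 l2 u) comm j.
move/matrixP => /(_ i k); rewrite !christoffel_upE => ->.
by rewrite mx_lincombE.
Qed.

(** The derivative terms of the curvature are linear because the relation
    between the connections holds near the point.  The quadratic terms for
    (i, j) and (j, i) have the same defect, and the curvature contains their
    difference. *)
Lemma nonsingular_curvature_linear (l1 l2 : R) :
  nonsingular_pair U g1 g2 -> (forall u, U u -> difference_self_adjoint u) ->
  curvature_linear U g1 g2 l1 l2.
Proof.
move=> nonsing comm u Uu du i j k l.
have ru : nondegenerate_locus l1 l2 u by [].
have g_unit : l1 *: g1 u + l2 *: g2 u \in unitmx by rewrite unitmxE unitfE.
have LC1 := christoffel_levi_civita openU metric1 Uu.
have LC2 := christoffel_levi_civita openU metric2 Uu.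
have [C_sym _] := pencil_levi_civita ru.
have quad i' j' := pencil_curvature_quadratic (metric_symmetric metric1 Uu)
  (metric_symmetric metric2 Uu) LC1 LC2 g_unit C_sym
  (connection_linear_of_self_adjoint ru (comm u Uu)) i' j'.
have [r [r_uniq r_size r_root]] := nonsing u Uu.
have cross := cross_term_sym (metric_unit metric2 Uu) g_unit r_uniq r_size
  (fun lambda lr => (r_root lambda).1 lr) (comm u Uu i) (comm u Uu j).
have partial_up m n : partial m (christoffel_up (pencil g1 g2 l1 l2) i j n) u =
    l1 * partial m (christoffel_up g1 i j n) u
    + l2 * partial m (christoffel_up g2 i j n) u.
  have D_up g : contravariant_metric U g ->
      has_partials (christoffel_up g i j n) u.
    move=> metric_g; apply: has_partials_sum => s; apply: has_partialsM.
      exact: (metric_has_partials metric_g).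
    exact: (christoffel_has_partials openU metric_g).
  rewrite (partial_ext (@open_nondegenerate_locus l1 l2) ru (h := fun w =>
    l1 * christoffel_up g1 i j n w + l2 * christoffel_up g2 i j n w)).
    exact: partial_lincomb (D_up _ metric1) (D_up _ metric2).
  move=> w rw; have [Uw _] := rw.
  have /matrixP/(_ i n) := connection_linear_of_self_adjoint rw (comm w Uw) j.
  by rewrite !christoffel_upE => ->; rewrite mx_lincombE.
rewrite (curvature_upE (@open_nondegenerate_locus l1 l2)
  (@pencil_metric l1 l2)) //.
rewrite (curvature_upE openU metric1) // (curvature_upE openU metric2) //.
rewrite !partial_up [pencil _ _ _ _ _]/pencil !quad cross.
have regroup a1 a2 b1 b2 c1 c2 d1 d2 x :
    l1 * a1 + l2 * a2 - (l1 * b1 + l2 * b2)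
    + (l1 * c1 + l2 * c2 - x - (l1 * d1 + l2 * d2 - x)) =
    l1 * (a1 - b1 + (c1 - d1)) + l2 * (a2 - b2 + (c2 - d2)) by ring.
by rewrite !mx_subE !mx_lincombE; apply: regroup.
Qed.

End Pair.

Theorem theorem2p4 (R : realType) (N : nat) (U : set 'rV[R]_N)
    (g1 g2 : 'rV[R]_N -> 'M[R]_N) (openU : open U)
    (metric1 : contravariant_metric U g1)
    (metric2 : contravariant_metric U g2) :
  ((almost_compatible U g1 g2 -> nijenhuis_vanishes U (affinor g1 g2)) /\
   (compatible U g1 g2 -> nijenhuis_vanishes U (affinor g1 g2))) /\
  (nonsingular_pair U g1 g2 ->
   (nijenhuis_vanishes U (affinor g1 g2) -> compatible U g1 g2) /\
   (compatible U g1 g2 <-> almost_compatible U g1 g2)).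
Proof.
have weaken : compatible U g1 g2 -> almost_compatible U g1 g2.
  by move=> comp l1 l2 /comp [].
have almost_nij : almost_compatible U g1 g2 ->
    nijenhuis_vanishes U (affinor g1 g2).
  move=> ac u Uu.
  apply/(nijenhuis_zero_iff_difference_self_adjoint openU) => //.
  exact: almost_compatible_difference_self_adjoint ac.
have nij_comp : nonsingular_pair U g1 g2 ->
    nijenhuis_vanishes U (affinor g1 g2) -> compatible U g1 g2.
  move=> nonsing nij0 l1 l2 nz; split.
    exact: nijenhuis_almost_compatible nz.
  apply: nonsingular_curvature_linear => // u Uu.
  apply/(nijenhuis_zero_iff_difference_self_adjoint openU) => //.
  exact: nij0.
split; first by split=> // /weaken.
move=> nonsing; split; first exact: nij_comp.
by split=> // /almost_nij; exact: nij_comp.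
Qed.
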